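(* Let $Q$ be a Hausdorff, connected, locally path-connected space and let $G$ be a simultaneously locally path-connected $Q$-group. The family of cohomology functors $[M\mapsto H^k_Q(G;M_Q)]_{k\geq0}$ has a canonical structure of $\delta$-functor on the category of $\hat\pi_0(G)$-modules.
   Context: A $Q$-space is a Hausdorff, locally path-connected space $X$ with a continuous map $X\to Q$, written $x\mapsto \|x\|$. A $Q$-group is a group object in $Q$-spaces (continuous multiplication $m:G\times_Q G\to G$, unit $Q\to G$ and inverse $G\to G$ over $Q$, making every fibre a group). For a discrete group $D$, $D_Q$ denotes $D\times Q\to Q$ with fibrewise law. $G^k_Q$ is the $k$-fold fibre product of $G$ over $Q$ ($G^0_Q=Q$); $G$ is simultaneously locally path-connected if $G^k_Q$ is locally path-connected for every $k\ge 0$. The group $\hat\pi_0(G)$: for $c_1,c_2\in\pi_0(G)$ let $c_1\cdot c_2$ be the set of connected components of $G$ meeting $m(c_1\times_Q c_2)$; $\hat\pi_0(G)=\langle \pi_0(G)\mid c_1c_2c_3^{-1},\ c_3\in c_1\cdot c_2\rangle$. $\eta_G:G\to\hat\pi_0(G)$ sends $g$ to the class of its connected component. If $M$ is a $\hat\pi_0(G)$-module (a discrete abelian group), $M_Q=M\times Q$ is a $G$-module via $g\cdot(m;\|g\|)=(\eta_G(g)m;\|g\|)$. Cohomology: $C^k_Q(G;M_Q)$ is the group of morphisms of $Q$-spaces (continuous maps over $Q$) $\alpha:G^k_Q\to M_Q$, with differential $$d\alpha(g_1;\dots;g_{k+1})=g_1\cdot\alpha(g_2;\dots;g_{k+1})+\sum_{i=1}^k(-1)^i\alpha(g_1;\dots;g_ig_{i+1};\dots;g_{k+1})+(-1)^{k+1}\alpha(g_1;\dots;g_k),$$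 and $H^k_Q(G;M_Q)$ is its cohomology. The $\delta$-functor structure is the one given by connecting morphisms of long exact sequences attached to short exact sequences of $\hat\pi_0(G)$-modules. *)

(* Defs.v *)
From HB Require Import structures.
From mathcomp Require Import all_boot all_order all_algebra generic_quotient.
From mathcomp Require Import ring_quotient.
From mathcomp Require Import all_classical all_reals topology normedtype.

Set Implicit Arguments.
Unset Strict Implicit.
Unset Printing Implicit Defensive.

Import Order.TTheory GRing.Theory Num.Theory.
Import numFieldNormedType.Exports.
Local Open Scope classical_set_scope.
Local Open Scope ring_scope.
Local Open Scope quotient_scope.

Section LocallyPathConnected.
Variable R : realType.

Definition path_connected (T : topologicalType) (A : set T) : Prop :=
  forall x y, A x -> A y ->
    exists gamma : R -> T,
      [/\ {within `[0, 1], continuous gamma}, gamma 0 = x, gamma 1 = y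
        & gamma @` `[0, 1] `<=` A].

Definition locally_path_connected (T : topologicalType) : Prop :=
  forall (x : T) (U : set T), nbhs x U ->
    exists V : set T, [/\ open V, V x, V `<=` U & path_connected V].

Lemma path_connected_connected (T : topologicalType) (A : set T) x :
  path_connected A -> A x -> A `<=` connected_component setT x.
Proof.
move=> pA Ax y Ay; have [g [gc g0 g1 gA]] := pA _ _ Ax Ay.
exists (g @` `[0, 1]); last first.
  by exists 1 => //; rewrite /= in_itv /= lexx ler01.
split => //.
  by exists 0 => //; rewrite /= in_itv /= lexx ler01.
by apply: connected_continuous_connected => //; exact: segment_connected.
Qed.

Lemma nbhs_connected_component (T : topologicalType) (x : T) :
  locally_path_connected T -> nbhs x (connected_component setT x).
Proof.
move=> lpc; have [V [oV Vx _ pV]] := lpc x setT filterT.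
apply: filterS (path_connected_connected pV Vx) _.
exact: open_nbhs_nbhs.
Qed.

End LocallyPathConnected.

Lemma continuous_set_type (Y X : topologicalType) (A : set X) (f : Y -> A) :
  continuous (fun y => set_val (f y)) -> continuous f.
Proof.
move=> cf y U [_ [[W oW <-] /= Wfy WU]].
apply: (filterS (P := (fun y => set_val (f y)) @^-1` W)).
  by move=> z /= Wz; exact: WU.
by apply: cf; exact: open_nbhs_nbhs.
Qed.

Lemma continuous_set_val (X : topologicalType) (A : set X) :
  continuous (set_val : A -> X).
Proof. exact: initial_continuous. Qed.

Lemma continuous_prod_topology (Y : topologicalType) (I : eqType)
    (K : I -> topologicalType) (f : Y -> prod_topology K) :
  (forall i, continuous (fun y => f y i)) -> continuous f.
Proof.
move=> cf y; apply/cvg_sup => i U [/= _ [[V oV <-] /= Vfy /filterS]]; apply.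
by apply: (cf i y); exact: open_nbhs_nbhs.
Qed.

Lemma continuous_proj (I : eqType) (K : I -> topologicalType) (i : I) :
  continuous (fun f : prod_topology K => f i).
Proof. exact: proj_continuous. Qed.

Lemma continuous_discrete (T : topologicalType) (D : choiceType)
    (c : T -> discrete_topology D) :
  continuous c <-> forall x, nbhs x [set y | c y = c x].
Proof.
split=> cc x; first exact: (cc x _ (discrete_set1 (c x))).
by apply/discrete_cvg; exact: cc.
Qed.

Record overspace (Q : topologicalType) := Overspace {
  os_sort :> topologicalType;
  qnorm : os_sort -> Q;
  qnorm_continuous : continuous qnorm }.
Arguments qnorm {Q o} _.

Record qhom (Q : topologicalType) (X Y : overspace Q) := Qhom {
  qhom_fun :> X -> Y;
  qhom_continuous : continuous qhom_fun;
  qhom_over : forall x, qnorm (qhom_fun x) = qnorm x }.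

Lemma qhom_eq (Q : topologicalType) (X Y : overspace Q) (f g : qhom X Y) :
  f =1 g -> f = g.
Proof.
case: f g => f cf of_ [g cg og] /= /funext fg; case: _ / fg in cg og *.
by congr Qhom; exact: Prop_irrelevance.
Qed.

Definition qspace_axioms (R : realType) (Q : topologicalType)
    (X : overspace Q) : Prop :=
  hausdorff_space X /\ locally_path_connected R X.

Section Constructions.
Variable Q : topologicalType.
Implicit Types X Y : overspace Q.

Lemma base_space_continuous : continuous (fun q : Q => q).
Proof. by move=> q; exact: cvg_id. Qed.

Definition base_space : overspace Q := Overspace base_space_continuous.

Lemma const_space_continuous (D : choiceType) :
  continuous (snd : discrete_topology D * Q -> Q).
Proof. by move=> x; exact: cvg_snd. Qed.

Definition const_space (D : choiceType) : overspace Q :=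
  Overspace (@const_space_continuous D).

Definition fibprod_set X Y : set (X * Y) := [set p | qnorm p.1 = qnorm p.2].
Arguments fibprod_set : clear implicits.

Definition fibprod_norm X Y (p : fibprod_set X Y) : Q := qnorm (set_val p).1.

Lemma fibprod_norm_continuous X Y : continuous (@fibprod_norm X Y).
Proof.
move=> p; apply: (@continuous_comp _ _ _ (fst \o set_val) qnorm); last first.
  exact: qnorm_continuous.
by apply: continuous_comp; [exact: continuous_set_val | exact: cvg_fst].
Qed.

Definition fibprod X Y : overspace Q :=
  Overspace (@fibprod_norm_continuous X Y).

Definition fpair X Y (x : X) (y : Y) (xy : qnorm x = qnorm y) : fibprod X Y :=
  exist _ (x, y) (mem_set xy).

(* The k-fold fibre product, as the limit of k copies of X -> Q: the base    *)
(* point is redundant for k > 0 and makes the 0-fold product equal to Q.     *)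
Definition fibpow_set X (k : nat) : set (Q * prod_topology (fun _ : 'I_k => X))
  := [set x | forall i, qnorm (x.2 i) = x.1].
Arguments fibpow_set : clear implicits.

Definition fibpow_norm X k (x : fibpow_set X k) : Q := (set_val x).1.

Lemma fibpow_norm_continuous X k : continuous (@fibpow_norm X k).
Proof.
move=> p; apply: (@continuous_comp _ _ _ set_val fst).
  exact: continuous_set_val.
exact: cvg_fst.
Qed.

Definition fibpow X k : overspace Q := Overspace (@fibpow_norm_continuous X k).

Definition gcoord X k (x : fibpow X k) (i : 'I_k) : X := (set_val x).2 i.

Lemma gcoordE X k (x : fibpow X k) i : qnorm (gcoord x i) = qnorm x.
Proof. exact: (set_mem (valP x) i). Qed.

Definition mk_fibpow X k (q : Q) (x : 'I_k -> X)
    (xq : forall i, qnorm (x i) = q) : fibpow X k :=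
  exist _ (q, x) (mem_set xq).

Lemma gcoord_continuous X k (i : 'I_k) :
  continuous (fun x : fibpow X k => gcoord x i).
Proof.
move=> x; apply: (@continuous_comp _ _ _ (fun x : fibpow X k => (set_val x).2)
  (fun f : prod_topology _ => f i)); last exact: continuous_proj.
apply: (@continuous_comp _ _ _ set_val snd).
  exact: continuous_set_val.
exact: cvg_snd.
Qed.

Lemma mk_fibpow_continuous (T : topologicalType) X k (q : T -> Q)
    (x : T -> 'I_k -> X) (xq : forall t i, qnorm (x t i) = q t) :
  continuous q -> (forall i, continuous (fun t => x t i)) ->
  continuous (fun t => mk_fibpow (xq t)).
Proof.
move=> cq cx; apply: continuous_set_type => t.
exact: (cvg_pair (cq t) (@continuous_prod_topology _ _
  (fun _ : 'I_k => X : topologicalType) x cx t)).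
Qed.

Lemma fpair_continuous (T : topologicalType) X Y (x : T -> X) (y : T -> Y)
    (xy : forall t, qnorm (x t) = qnorm (y t)) :
  continuous x -> continuous y -> continuous (fun t => fpair (xy t)).
Proof.
move=> cx cy; apply: continuous_set_type => t.
exact: (cvg_pair (cx t) (cy t)).
Qed.

End Constructions.

Record qgroup (R : realType) (Q : topologicalType) := Qgroup {
  qg_space :> overspace Q;
  qg_qspace : qspace_axioms R qg_space;
  qmul : qhom (fibprod qg_space qg_space) qg_space;
  qone : qhom (base_space Q) qg_space;
  qinv : qhom qg_space qg_space;
  qmulA : forall (x y z : qg_space) (xy : qnorm x = qnorm y)
    (yz : qnorm y = qnorm z) (xy_z : qnorm (qmul (fpair xy)) = qnorm z)
    (x_yz : qnorm x = qnorm (qmul (fpair yz))),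
    qmul (fpair x_yz) = qmul (fpair xy_z);
  qmul1g : forall (x : qg_space) (ex : qnorm (qone (qnorm x)) = qnorm x),
    qmul (fpair ex) = x;
  qmulg1 : forall (x : qg_space) (xe : qnorm x = qnorm (qone (qnorm x))),
    qmul (fpair xe) = x;
  qmulVg : forall (x : qg_space) (ix : qnorm (qinv x) = qnorm x),
    qmul (fpair ix) = qone (qnorm x);
  qmulgV : forall (x : qg_space) (xi : qnorm x = qnorm (qinv x)),
    qmul (fpair xi) = qone (qnorm x) }.

(* Includes k = 0, where fibpow G 0 is the base Q. *)
Definition simultaneously_lpc R Q (G : qgroup R Q) : Prop :=
  forall k, locally_path_connected R (fibpow G k).

Section Presentation.
Variables (X : choiceType) (rels : set (seq (X * bool))).

(* (x, true) stands for x and (x, false) for its inverse. *)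
Local Notation word := (seq (X * bool)).

Inductive pres_rel : word -> word -> Prop :=
| pres_refl u : pres_rel u u
| pres_sym u v : pres_rel u v -> pres_rel v u
| pres_trans u v w : pres_rel u v -> pres_rel v w -> pres_rel u w
| pres_cat u u' v v' :
    pres_rel u u' -> pres_rel v v' -> pres_rel (u ++ v) (u' ++ v')
| pres_cancel x b : pres_rel [:: (x, b); (x, ~~ b)] [::]
| pres_relator r : rels r -> pres_rel r [::].

Definition pres_eq : rel word := fun u v => `[< pres_rel u v >].

Lemma pres_eq_equiv : equiv_class_of pres_eq.
Proof.
split=> [u|u v|v u w].
- by apply/asboolP; exact: pres_refl.
- by apply/asboolP/asboolP; exact: pres_sym.
- by move=> /asboolP uv /asboolP vw; apply/asboolP; exact: pres_trans uv vw.
Qed.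

Canonical pres_equiv := EquivRelPack pres_eq_equiv.
Canonical pres_encModRel := defaultEncModRel pres_eq.

Definition presented : Type := {eq_quot pres_eq}.
HB.instance Definition _ := Choice.on presented.
HB.instance Definition _ := EqQuotient.on presented.

Lemma presP (u v : word) :
  pres_rel u v <-> \pi_presented u = \pi_presented v.
Proof.
split=> [uv|/eqmodP/asboolP//]; exact/eqmodP/asboolP.
Qed.

Definition winv (u : word) : word := rev [seq (a.1, ~~ a.2) | a <- u].

Lemma winv_cat u v : winv (u ++ v) = winv v ++ winv u.
Proof. by rewrite /winv map_cat rev_cat. Qed.

Lemma winvK : involutive winv.
Proof.
move=> u; rewrite /winv map_rev revK -map_comp map_id_in// => -[x b] _ /=.
by rewrite negbK.
Qed.

Lemma pres_mulgV u : pres_rel (u ++ winv u) [::].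
Proof.
elim: u => [|[x b] u IHu]; first exact: pres_refl.
rewrite -cat1s winv_cat -catA (catA u).
apply: pres_trans (pres_cancel x b).
rewrite -[X in pres_rel _ X]cat1s.
apply: pres_cat; first exact: pres_refl.
rewrite -[X in pres_rel _ X]cat0s.
by apply: pres_cat; last exact: pres_refl.
Qed.

Lemma pres_mulVg u : pres_rel (winv u ++ u) [::].
Proof. by rewrite -{2}[u]winvK; exact: pres_mulgV. Qed.

Lemma pres_inv u v : pres_rel u v -> pres_rel (winv u) (winv v).
Proof.
move=> uv; apply: pres_trans (_ : pres_rel _ (winv u ++ (v ++ winv v))) _.
  rewrite -[X in pres_rel X _]cats0.
  by apply: pres_cat; [exact: pres_refl | exact/pres_sym/pres_mulgV].
rewrite catA -[X in pres_rel _ X]cat0s.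
apply: pres_cat; last exact: pres_refl.
apply: pres_trans (pres_mulVg u).
by apply: pres_cat; [exact: pres_refl | exact: pres_sym].
Qed.

Definition pres_mul (a b : presented) : presented :=
  \pi_presented (repr a ++ repr b).
Definition pres_one : presented := \pi_presented [::].
Definition pres_invg (a : presented) : presented :=
  \pi_presented (winv (repr a)).

Lemma pres_repr u : pres_rel (repr (\pi_presented u)) u.
Proof. by apply/presP; rewrite reprK. Qed.

Lemma pres_mulE u v :
  pres_mul (\pi_presented u) (\pi_presented v) = \pi_presented (u ++ v).
Proof. by apply/presP; apply: pres_cat; exact: pres_repr. Qed.

Lemma pres_invE u : pres_invg (\pi_presented u) = \pi_presented (winv u).
Proof. by apply/presP; apply: pres_inv; exact: pres_repr. Qed.

Lemma pres_mulA : associative pres_mul.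
Proof.
elim/quotW=> a; elim/quotW=> b; elim/quotW=> c.
by rewrite (pres_mulE b) (pres_mulE a) (pres_mulE a b) pres_mulE catA.
Qed.

Lemma pres_mul1g : left_id pres_one pres_mul.
Proof. by elim/quotW=> a; rewrite pres_mulE. Qed.

Lemma pres_mulg1 : right_id pres_one pres_mul.
Proof. by elim/quotW=> a; rewrite pres_mulE cats0. Qed.

Lemma pres_mulVg_subproof : left_inverse pres_one pres_invg pres_mul.
Proof.
elim/quotW=> a; rewrite pres_invE pres_mulE.
by apply/presP; exact: pres_mulVg.
Qed.

Lemma pres_mulgV_subproof : right_inverse pres_one pres_invg pres_mul.
Proof.
elim/quotW=> a; rewrite pres_invE pres_mulE.
by apply/presP; exact: pres_mulgV.
Qed.

HB.instance Definition _ := isGroup.Build presented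
  pres_mulA pres_mul1g pres_mulg1 pres_mulVg_subproof pres_mulgV_subproof.

Definition pres_gen (x : X) : presented := \pi_presented [:: (x, true)].

End Presentation.

Section HatPi0.
Variables (R : realType) (Q : topologicalType) (G : qgroup R Q).

Definition pi0 (T : topologicalType) : set (set T) :=
  range (connected_component setT).
Arguments pi0 : clear implicits.

Definition component (T : topologicalType) (x : T) : pi0 T :=
  exist _ (connected_component setT x) (mem_set (imageT _ x)).

Definition pi0_mul (c1 c2 : pi0 G) : set (pi0 G) :=
  [set c3 | set_val c3 `&` (qmul G @` [set p : fibprod G G |
     set_val c1 (set_val p).1 /\ set_val c2 (set_val p).2]) !=set0].

Definition hat_relators : set (seq (pi0 G * bool)) :=
  [set r | exists c1 c2 c3, pi0_mul c1 c2 c3 /\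
     r = [:: (c1, true); (c2, true); (c3, false)]].

Definition hat_pi0 : groupType := presented hat_relators.

Definition eta (g : G) : hat_pi0 := pres_gen hat_relators (component g).

Lemma eta_locally_constant (g : G) : nbhs g [set h | eta h = eta g].
Proof.
apply: filterS (nbhs_connected_component g (qg_qspace G).2) => h gh /=.
rewrite /eta; congr pres_gen; apply: val_inj => /=.
exact/esym/same_connected_component.
Qed.

End HatPi0.

Section Modules.
Variable Gamma : groupType.

Record gmodule := Gmodule {
  gm_sort :> zmodType;
  gact : Gamma -> gm_sort -> gm_sort;
  gact1 : forall m, gact 1%g m = m;
  gactM : forall a b m, gact (a * b)%g m = gact a (gact b m);
  gactD : forall a m n, gact a (m + n) = gact a m + gact a n }.

Lemma gactB M a (m n : gm_sort M) : gact a (m - n) = gact a m - gact a n.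
Proof. by apply: (addIr (gact a n)); rewrite -gactD !subrK. Qed.

Record ghom (M N : gmodule) := Ghom {
  ghom_fun :> {additive M -> N};
  ghomJ : forall a m, ghom_fun (gact a m) = gact a (ghom_fun m) }.

Program Definition ghom_id (M : gmodule) : ghom M M := @Ghom M M idfun _.
Next Obligation. by []. Qed.

Program Definition ghom_comp (M N P : gmodule) (g : ghom N P) (f : ghom M N) :
  ghom M P := @Ghom M P (g \o f) _.
Next Obligation. by move=> M N P g f a m; rewrite /= !ghomJ. Qed.

Program Definition ghom_add (M N : gmodule) (f g : ghom M N) : ghom M N :=
  @Ghom M N (f \+ g) _.
Next Obligation. by move=> M N f g a m; rewrite /= !ghomJ gactD. Qed.

Record ses := Ses {
  ses_sub : gmodule;
  ses_mid : gmodule;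
  ses_quo : gmodule;
  ses_inj : ghom ses_sub ses_mid;
  ses_proj : ghom ses_mid ses_quo;
  ses_injP : injective ses_inj;
  ses_projP : forall z, exists y, ses_proj y = z;
  ses_exact : forall y, ses_proj y = 0 <-> exists x, ses_inj x = y }.

Record ses_hom (S S' : ses) := SesHom {
  sh_sub : ghom (ses_sub S) (ses_sub S');
  sh_mid : ghom (ses_mid S) (ses_mid S');
  sh_quo : ghom (ses_quo S) (ses_quo S');
  sh_inj : forall x, sh_mid (ses_inj S x) = ses_inj S' (sh_sub x);
  sh_proj : forall y, sh_quo (ses_proj S y) = ses_proj S' (sh_mid y) }.

(* A cohomological delta-functor from Gamma-modules to abelian groups,       *)
(* vanishing in negative degrees (whence the injectivity in degree 0).       *)
Record delta_functor (T : nat -> gmodule -> zmodType)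
    (Tmap : forall k M N, ghom M N -> {additive T k M -> T k N})
    (delta : forall k (S : ses),
      {additive T k (ses_quo S) -> T k.+1 (ses_sub S)}) : Prop := {
  df_id : forall k M x, Tmap k M M (ghom_id M) x = x;
  df_comp : forall k M N P (g : ghom N P) (f : ghom M N) x,
    Tmap k M P (ghom_comp g f) x = Tmap k N P g (Tmap k M N f x);
  df_add : forall k M N (f g : ghom M N) x,
    Tmap k M N (ghom_add f g) x = Tmap k M N f x + Tmap k M N g x;
  df_natural : forall k S S' (s : ses_hom S S') z,
    Tmap k.+1 _ _ (sh_sub s) (delta k S z) =
    delta k S' (Tmap k _ _ (sh_quo s) z);
  df_exact0 : forall S, injective (Tmap 0 _ _ (ses_inj S));
  df_exact_mid : forall k S y,
    Tmap k _ _ (ses_proj S) y = 0 <-> exists x, Tmap k _ _ (ses_inj S) x = y;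
  df_exact_quo : forall k S z,
    delta k S z = 0 <-> exists y, Tmap k _ _ (ses_proj S) y = z;
  df_exact_sub : forall k S x,
    Tmap k.+1 _ _ (ses_inj S) x = 0 <-> exists z, delta k S z = x }.

End Modules.

Section Cochains.
Variables (R : realType) (Q : topologicalType) (G : qgroup R Q).
Implicit Types (M N : gmodule (hat_pi0 G)) (k : nat).

Definition cochain k M : Type := qhom (fibpow G k) (const_space Q M).
HB.instance Definition _ k M := gen_eqMixin (cochain k M).
HB.instance Definition _ k M := gen_choiceMixin (cochain k M).

Definition value k M (a : cochain k M) (x : fibpow G k) : M := (a x).1.

Lemma value_continuous k M (a : cochain k M) :
  continuous (value a : fibpow G k -> discrete_topology M).
Proof.
move=> x; apply: (@continuous_comp _ _ _ a fst); last exact: cvg_fst.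
exact: qhom_continuous.
Qed.

Lemma value_locally_constant k M (a : cochain k M) x :
  nbhs x [set y | value a y = value a x].
Proof.
by apply: ((continuous_discrete (D := M) (value a)).1 _ x); exact: value_continuous.
Qed.

Lemma mk_cochain_continuous k M (c : fibpow G k -> M) :
  (forall x, nbhs x [set y | c y = c x]) ->
  continuous (fun x => (c x, qnorm x) : const_space Q M).
Proof.
move=> cc x; have {}cc := (continuous_discrete (D := M) c).2 cc x.
have cq := @qnorm_continuous _ (fibpow G k) x.
exact: (@cvg_pair _ (discrete_topology M) Q (nbhs x)
  (nbhs (c x : discrete_topology M)) (nbhs (qnorm x)) _ _ _ c qnorm cc cq).
Qed.

Definition mk_cochain k M (c : fibpow G k -> M)
    (cc : forall x, nbhs x [set y | c y = c x]) : cochain k M :=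
  @Qhom Q (fibpow G k) (const_space Q M) _ (mk_cochain_continuous cc)
    (fun=> erefl).

Lemma value_inj k M (a b : cochain k M) : value a =1 value b -> a = b.
Proof.
move=> ab; apply: qhom_eq => x.
rewrite [a x]surjective_pairing [b x]surjective_pairing.
congr pair; first exact: ab.
by have /= -> := qhom_over a x; have /= -> := qhom_over b x.
Qed.

(* The group law is the fibrewise one of M_Q. *)
Program Definition cochain_zero k M : cochain k M :=
  mk_cochain (c := fun=> 0) _.
Next Obligation. by move=> k M x; exact: filterE. Qed.

Program Definition cochain_opp k M (a : cochain k M) : cochain k M :=
  mk_cochain (c := fun x => - value a x) _.
Next Obligation.
by move=> k M a x; apply: filterS (value_locally_constant a x) => y /= ->.
Qed.

Program Definition cochain_add k M (a b : cochain k M) : cochain k M :=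
  mk_cochain (c := fun x => value a x + value b x) _.
Next Obligation.
by move=> k M a b x; apply: filterS2 (value_locally_constant a x)
  (value_locally_constant b x) => y /= -> ->.
Qed.

Lemma cochain_addA k M : associative (@cochain_add k M).
Proof. by move=> a b c; apply: value_inj => x; exact: addrA. Qed.
Lemma cochain_addC k M : commutative (@cochain_add k M).
Proof. by move=> a b; apply: value_inj => x; exact: addrC. Qed.
Lemma cochain_add0 k M : left_id (@cochain_zero k M) (@cochain_add k M).
Proof. by move=> a; apply: value_inj => x; exact: add0r. Qed.
Lemma cochain_addN k M :
  left_inverse (@cochain_zero k M) (@cochain_opp k M) (@cochain_add k M).
Proof. by move=> a; apply: value_inj => x; exact: addNr. Qed.

HB.instance Definition _ k M := GRing.isZmodule.Build (cochain k M)
  (@cochain_addA k M) (@cochain_addC k M) (@cochain_add0 k M)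
  (@cochain_addN k M).

Lemma valueD k M (a b : cochain k M) x : value (a + b) x = value a x + value b x.
Proof. by []. Qed.
Lemma valueN k M (a : cochain k M) x : value (- a) x = - value a x.
Proof. by []. Qed.
Lemma value0 k M x : value (0 : cochain k M) x = 0.
Proof. by []. Qed.

Lemma qmul_norm (g h : G) (gh : qnorm g = qnorm h) :
  qnorm (qmul G (fpair gh)) = qnorm g.
Proof. exact: qhom_over. Qed.

Section Faces.
Variable k : nat.

Definition drop_first (x : fibpow G k.+1) : fibpow G k :=
  mk_fibpow (fun j : 'I_k => gcoordE x (lift ord0 j)).

Definition drop_last (x : fibpow G k.+1) : fibpow G k :=
  mk_fibpow (fun j : 'I_k => gcoordE x (widen_ord (leqnSn k) j)).

Lemma contract_norm_eq (x : fibpow G k.+1) (i : 'I_k) :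
  qnorm (gcoord x (widen_ord (leqnSn k) i)) = qnorm (gcoord x (lift ord0 i)).
Proof. by rewrite !gcoordE. Qed.

Definition contract_coord (i : 'I_k) (x : fibpow G k.+1) (j : 'I_k) : G :=
  if (j < i)%N then gcoord x (widen_ord (leqnSn k) j)
  else if j == i then qmul G (fpair (contract_norm_eq x i))
  else gcoord x (lift ord0 j).

Lemma contract_coordE i x j : qnorm (contract_coord i x j) = qnorm x.
Proof.
rewrite /contract_coord; case: ifP => _; first exact: gcoordE.
by case: ifP => _; rewrite ?qmul_norm gcoordE.
Qed.

(* With i counted from 0:                                                    *)
(* (g_1; ...; g_{k+1}) |-> (g_1; ...; g_{i+1} g_{i+2}; ...; g_{k+1})         *)
Definition contract (i : 'I_k) (x : fibpow G k.+1) : fibpow G k :=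
  mk_fibpow (contract_coordE i x).

Lemma drop_first_continuous : continuous drop_first.
Proof.
apply: mk_fibpow_continuous; first exact: qnorm_continuous.
by move=> j; exact: gcoord_continuous.
Qed.

Lemma drop_last_continuous : continuous drop_last.
Proof.
apply: mk_fibpow_continuous; first exact: qnorm_continuous.
by move=> j; exact: gcoord_continuous.
Qed.

Lemma contract_continuous i : continuous (contract i).
Proof.
apply: mk_fibpow_continuous; first exact: qnorm_continuous.
move=> j; rewrite /contract_coord.
case: (j < i)%N; first exact: gcoord_continuous.
case: (j == i); last exact: gcoord_continuous.
move=> x; apply: (@continuous_comp _ _ _
  (fun x => fpair (contract_norm_eq x i)) (qmul G)); last first.
  exact: qhom_continuous.
by apply: fpair_continuous; exact: gcoord_continuous.
Qed.

End Faces.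

(* The M-component of the differential: all the terms lie in the same fibre  *)
(* M x {qnorm x}, g acts on M_Q by (m; q) |-> (eta g m; q), and the index i  *)
(* of the sum is counted from 0, whence the exponent i + 1.                  *)
Definition dvalue k M (a : cochain k M) (x : fibpow G k.+1) : M :=
  gact (eta (gcoord x ord0)) (value a (drop_first x))
  + \sum_(i < k) value a (contract i x) *~ (-1) ^+ i.+1
  + value a (drop_last x) *~ (-1) ^+ k.+1.

Lemma value_comp_locally_constant k l M (a : cochain k M)
    (f : fibpow G l -> fibpow G k) x :
  continuous f -> nbhs x [set y | value a (f y) = value a (f x)].
Proof. by move=> cf; exact: (cf x _ (value_locally_constant a (f x))). Qed.

Lemma dvalue_locally_constant k M (a : cochain k M) x :
  nbhs x [set y | dvalue a y = dvalue a x].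
Proof.
have e0 : nbhs x [set y | eta (gcoord y ord0) = eta (gcoord x ord0)].
  exact: (gcoord_continuous (eta_locally_constant (gcoord x ord0))).
have f0 := value_comp_locally_constant a x (@drop_first_continuous k).
have l0 := value_comp_locally_constant a x (@drop_last_continuous k).
have c0 : nbhs x [set y | forall i : 'I_k,
    value a (contract i y) = value a (contract i x)].
  apply: (@filter_forall _ _ (fun i : 'I_k =>
    [set y | value a (contract i y) = value a (contract i x)]) (nbhs x)) => i.
  exact/value_comp_locally_constant/contract_continuous.
near=> y; rewrite /= /dvalue.
congr (_ + _ + _ *~ _).
- congr gact; first by near: y.
  by near: y.
- apply: eq_bigr => i _; congr (_ *~ _); move: i; near: y; exact: c0.
- by near: y.
Unshelve. all: by end_near. Qed.

Definition cdiff k M (a : cochain k M) : cochain k.+1 M :=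
  mk_cochain (dvalue_locally_constant a).

Lemma value_cdiff k M (a : cochain k M) x : value (cdiff a) x = dvalue a x.
Proof. by []. Qed.

Lemma cdiff_is_zmod_morphism k M : zmod_morphism (@cdiff k M).
Proof.
move=> a b; apply: value_inj => x; rewrite valueD valueN !value_cdiff /dvalue.
rewrite valueD valueN gactB valueD valueN mulrzBl.
rewrite (eq_bigr (fun i : 'I_k => value a (contract i x) *~ (-1) ^+ i.+1
    - value b (contract i x) *~ (-1) ^+ i.+1)); last first.
  by move=> i _; rewrite valueD valueN mulrzBl.
by rewrite sumrB [X in X + _]addrACA [LHS]addrACA -!opprD.
Qed.
HB.instance Definition _ k M := GRing.isZmodMorphism.Build
  (cochain k M) (cochain k.+1 M) (@cdiff k M) (@cdiff_is_zmod_morphism k M).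

Definition cocycle_pred k M : {pred cochain k M} := fun a => cdiff a == 0.
Lemma cocycle_closed k M : zmod_closed (@cocycle_pred k M).
Proof.
split=> [|a b]; rewrite !unfold_in ?raddf0// => /eqP da /eqP db.
by rewrite raddfB /= da db subr0.
Qed.
HB.instance Definition _ k M :=
  GRing.isZmodClosed.Build _ (@cocycle_pred k M) (@cocycle_closed k M).

Record cocycle k M := Cocycle {
  cocycle_val :> cochain k M;
  cocycleP : cocycle_val \in @cocycle_pred k M }.
HB.instance Definition _ k M := [isSub for @cocycle_val k M].
HB.instance Definition _ k M := [Choice of cocycle k M by <:].
HB.instance Definition _ k M := [SubChoice_isSubZmodule of cocycle k M by <:].

Definition is_coboundary k M : cocycle k M -> Prop :=
  match k with
  | 0 => fun z => z = 0
  | k'.+1 => fun z => exists b : cochain k' M, cdiff b = z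
  end.

Definition coboundary_pred k M : {pred cocycle k M} :=
  fun z => `[< is_coboundary z >].
Lemma coboundary_closed k M : zmod_closed (@coboundary_pred k M).
Proof.
split=> [|z z']; rewrite !unfold_in.
  by apply/asboolP; case: k => [|k] //=; exists 0; rewrite raddf0.
move=> /asboolP + /asboolP; case: k z z' => [|k] z z' /=.
  by move=> -> ->; apply/asboolP; rewrite /= subr0.
by move=> [b bz] [b' bz']; apply/asboolP; exists (b - b'); rewrite raddfB /= bz bz'.
Qed.
HB.instance Definition _ k M :=
  GRing.isZmodClosed.Build _ (@coboundary_pred k M) (@coboundary_closed k M).

Definition cohomology k M : zmodType := Quotient.quot (@coboundary_pred k M).

Definition cclass k M (z : cocycle k M) : cohomology k M :=
  \pi_(cohomology k M) z.

Lemma cclass_is_zmod_morphism k M : zmod_morphism (@cclass k M).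
Proof. by move=> z w; exact: (raddfB \pi_(cohomology k M)). Qed.
HB.instance Definition _ k M := GRing.isZmodMorphism.Build
  (cocycle k M) (cohomology k M) (@cclass k M) (@cclass_is_zmod_morphism k M).

Lemma cclass_surj k M (h : cohomology k M) : exists z, cclass z = h.
Proof. by exists (repr h); exact: reprK. Qed.


Section Functoriality.
Variables (M N : gmodule (hat_pi0 G)) (f : ghom M N).

Lemma cochain_map_subproof k (a : cochain k M) x :
  nbhs x [set y | f (value a y) = f (value a x)].
Proof. by apply: filterS (value_locally_constant a x) => y /= ->. Qed.

Definition cochain_map k (a : cochain k M) : cochain k N :=
  mk_cochain (cochain_map_subproof a).

Lemma cdiff_cochain_map k (a : cochain k M) :
  cdiff (cochain_map a) = cochain_map (cdiff a).
Proof.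
apply: value_inj => x; rewrite value_cdiff /= /value /= -/(value _ _).
rewrite /dvalue !raddfD /= ghomJ raddf_sum !raddfMz /=; congr (_ + _ + _).
by apply: eq_bigr => i _; rewrite raddfMz.
Qed.

Lemma cochain_map_is_zmod_morphism k : zmod_morphism (@cochain_map k).
Proof. by move=> a b; apply: value_inj => x; exact: raddfB. Qed.
HB.instance Definition _ k := GRing.isZmodMorphism.Build
  (cochain k M) (cochain k N) (@cochain_map k) (@cochain_map_is_zmod_morphism k).

Lemma cocycle_map_subproof k (z : cocycle k M) :
  cochain_map z \in @cocycle_pred k N.
Proof.
by have /eqP dz := cocycleP z; rewrite unfold_in cdiff_cochain_map dz raddf0.
Qed.

Definition cocycle_map k (z : cocycle k M) : cocycle k N :=
  Cocycle (cocycle_map_subproof z).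

Lemma cocycle_map_is_zmod_morphism k : zmod_morphism (@cocycle_map k).
Proof. by move=> a b; apply: val_inj; exact: (raddfB (@cochain_map k)). Qed.
HB.instance Definition _ k := GRing.isZmodMorphism.Build
  (cocycle k M) (cocycle k N) (@cocycle_map k) (@cocycle_map_is_zmod_morphism k).

Definition cohomology_map k (h : cohomology k M) : cohomology k N :=
  cclass (cocycle_map (repr h)).

Lemma cohomology_mapE k (z : cocycle k M) :
  cohomology_map (cclass z) = cclass (cocycle_map z).
Proof.
apply/eqP; rewrite -Quotient.idealrBE -raddfB /=.
have : repr (cclass z) - z \in @coboundary_pred k M.
  by rewrite Quotient.idealrBE reprK.
rewrite !unfold_in => /asboolP bz; apply/asboolP.
case: k z bz => [|k] z /=; first by move=> ->; rewrite raddf0.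
by move=> [b bz]; exists (cochain_map b); rewrite cdiff_cochain_map bz.
Qed.

Lemma cohomology_map_is_zmod_morphism k : zmod_morphism (@cohomology_map k).
Proof.
move=> h h'; have [z <-] := cclass_surj h; have [w <-] := cclass_surj h'.
by rewrite -raddfB !cohomology_mapE !raddfB.
Qed.
HB.instance Definition _ k := GRing.isZmodMorphism.Build
  (cohomology k M) (cohomology k N) (@cohomology_map k)
  (@cohomology_map_is_zmod_morphism k).

End Functoriality.

Definition cohomology_functor k M N (f : ghom M N) :
  {additive cohomology k M -> cohomology k N} := @cohomology_map M N f k.

(* The snake construction: lift a cocycle of the quotient to a cochain a of  *)
(* the middle module; its coboundary comes from a cocycle b of the submodule. *)
Definition is_connecting (delta : forall k (S : ses (hat_pi0 G)),
    {additive cohomology k (ses_quo S) -> cohomology k.+1 (ses_sub S)}) : Prop :=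
  forall k (S : ses (hat_pi0 G)) (a : cochain k (ses_mid S))
    (z : cocycle k (ses_quo S)) (b : cocycle k.+1 (ses_sub S)),
    cochain_map (ses_proj S) a = z ->
    cdiff a = cochain_map (ses_inj S) b ->
    delta k S (cclass z) = cclass b.

End Cochains.

(* Main.v *)
Require Import Defs.
From HB Require Import structures.
From mathcomp Require Import all_boot all_order all_algebra.
From mathcomp Require Import ring_quotient zify.
From mathcomp Require Import all_classical all_reals topology.

Set Implicit Arguments.
Unset Strict Implicit.
Unset Printing Implicit Defensive.

Import GRing.Theory.

(** The theorem is the long exact cohomology sequence of a short exact sequence
    of cochain complexes, and two things have to be seen to get it.

    The first is that C^*(G; M) is a complex (cdiffK).  The differential is an
    alternating sum over faces that merge two neighbouring entries of a tuple,
    the two extreme faces dropping an entry instead; the action of G enters only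
    in the term where the first entry is dropped.  All faces are given by one formula
    (face), so that the simplicial identity faceC is a single case analysis
    resting on associativity in the fibres, and the action factors satisfy the
    matching identity twistC because eta is multiplicative (eta_qmul), which is
    exactly what the relators of hat_pi0 impose.  The terms of the double sum
    then cancel in pairs (alternating_sum_eq0).

    The second is that M |-> C^k(G; M) is exact.  A cochain amounts to a locally
    constant function with values in M, and composing such a function with any
    map of sets, for instance a set-theoretic section of a surjection of
    modules, again gives a locally constant function (cochain_map_lift).  Hence
    cochains lift along surjections without any topological obstruction.

    What remains is the snake argument.  Degree 0, where the coboundaries
    vanish, is treated together with the positive degrees through one fact:
    along a surjection of modules, coboundaries lift to coboundaries
    (coboundary_lift).  Uniqueness of the connecting morphisms holds because
    every class of the quotient is represented by a cocycle to which the snake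
    construction applies (snake_exists), so its image is prescribed. *)

Local Open Scope classical_set_scope.
Local Open Scope ring_scope.

(** * Cancellation in alternating double sums *)

(** The hypothesis is the shape taken by the simplicial identities: the terms
    with j < i are matched with those with i <= j by (i+1, j) <-> (j, i), and
    matched terms carry opposite signs. *)
Lemma alternating_sum_eq0 (V : zmodType) n (T : nat -> nat -> V) :
  (forall i j, (j <= i < n)%N -> T i.+1 j = T j i) ->
  \sum_(i < n.+1) (\sum_(j < n) T i j *~ (-1) ^+ j) *~ (-1) ^+ i = 0.
Proof.
move=> Tsym; pose s i j := T i j *~ ((-1) ^+ i * (-1) ^+ j).
have -> : \sum_(i < n.+1) (\sum_(j < n) T i j *~ (-1) ^+ j) *~ (-1) ^+ i
    = \sum_(i < n.+1) \sum_(j < n | (j < i)%N) s i j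
      + \sum_(i < n.+1) \sum_(j < n | (i <= j)%N) s i j.
  rewrite -big_split; apply: eq_bigr => i _ /=.
  rewrite mulrz_suml (bigID (fun j : 'I_n => (j < i)%N)) /=.
  congr (_ + _); last under eq_bigl do rewrite -leqNgt.
    by apply: eq_bigr => j _; rewrite /s mulrC mulrzA.
  by apply: eq_bigr => j _; rewrite /s mulrC mulrzA.
(* The row i = 0 of the first sum and the row i = n of the second are empty;
   without them both sums range over i, j < n, the first shifted by one. *)
rewrite big_ord_recl big_pred0// add0r.
rewrite (big_ord_recr n) /= [X in _ + (_ + X)]big_pred0 ?addr0; last first.
  by move=> j; rewrite leqNgt ltn_ord.
rewrite [X in _ + X](exchange_big_dep xpredT)//= -big_split big1//= => i _.
rewrite (eq_bigl (fun j : 'I_n => (j <= i)%N))//.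
rewrite -big_split big1//= => j ji.
rewrite /s /bump /= add1n Tsym ?ji ?ltn_ord//.
by rewrite exprS mulN1r mulNr mulrNz mulrC addNr.
Qed.

(** * Faces of tuples and the square of the differential *)

Local Notation eta := Defs.eta.
Local Notation contract := Defs.contract.

Section Eta.
Variables (R : realType) (Q : topologicalType) (G : qgroup R Q).

(** The component of gh meets the product of those of g and h, at gh itself, so
    that the three components form a relator. *)
Lemma eta_qmul (g h : G) (gh : qnorm g = qnorm h) :
  eta (qmul G (fpair gh)) = (eta g * eta h)%g.
Proof.
set c := qmul G (fpair gh).
have rel : (eta g * eta h * (eta c)^-1)%g = 1%g.
  rewrite [(eta g * eta h)%g]pres_mulE [(eta c)^-1%g]pres_invE.
  rewrite [LHS]pres_mulE; apply/presP/pres_relator.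
  exists (component g), (component h), (component c); split => //.
  exists c; split; first exact: connected_component_refl.
  exists (fpair gh) => //=.
  by split; exact: connected_component_refl.
by rewrite (divg1_eq rel).
Qed.

End Eta.

Section Faces.
Variables (R : realType) (Q : topologicalType) (G : qgroup R Q).
Implicit Types (M : gmodule (hat_pi0 G)).

(** A total version of the multiplication, so that products can be rewritten
    without carrying proofs that the factors lie in the same fibre. *)
Definition fmul (g h : G) : G :=
  if pselect (qnorm g = qnorm h) is left gh then qmul G (fpair gh) else g.

Lemma fmulE (g h : G) (gh : qnorm g = qnorm h) : fmul g h = qmul G (fpair gh).
Proof.
rewrite /fmul; case: pselect => // gh'.
by rewrite (Prop_irrelevance gh' gh).
Qed.

Lemma qnorm_fmul (g h : G) : qnorm (fmul g h) = qnorm g.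
Proof. by rewrite /fmul; case: pselect => // gh; rewrite qmul_norm. Qed.

Lemma fmulA (f g h : G) : qnorm f = qnorm g -> qnorm g = qnorm h ->
  fmul f (fmul g h) = fmul (fmul f g) h.
Proof.
move=> fg gh.
have fg_h : qnorm (qmul G (fpair fg)) = qnorm h by rewrite qmul_norm fg.
have f_gh : qnorm f = qnorm (qmul G (fpair gh)) by rewrite qmul_norm.
by rewrite (fmulE fg) (fmulE gh) (fmulE fg_h) (fmulE f_gh) qmulA.
Qed.

Lemma eta_fmul (g h : G) : qnorm g = qnorm h ->
  eta (fmul g h) = (eta g * eta h)%g.
Proof. by move=> gh; rewrite (fmulE gh) eta_qmul. Qed.

(** The entries of a tuple indexed by natural numbers, padded with the unit of
    the fibre; index arithmetic then takes place in nat. *)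
Definition gnth k (x : fibpow G k) (n : nat) : G :=
  if insub n is Some i then gcoord x i else qone G (qnorm x).

Lemma gnth_ord k (x : fibpow G k) (i : 'I_k) : gnth x i = gcoord x i.
Proof. by rewrite /gnth valK. Qed.

Lemma qnorm_gnth k (x : fibpow G k) n : qnorm (gnth x n) = qnorm x.
Proof.
rewrite /gnth; case: insub => [i|]; first exact: gcoordE.
exact: (qhom_over (qone G)).
Qed.

Lemma fibpow_eq k (x y : fibpow G k) : qnorm x = qnorm y ->
  (forall n, (n < k)%N -> gnth x n = gnth y n) -> x = y.
Proof.
move=> qxy xy; apply: val_inj.
rewrite [val x]surjective_pairing [val y]surjective_pairing.
congr pair; first exact: qxy.
by apply: funext => i; have := xy i (ltn_ord i); rewrite !gnth_ord.
Qed.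

(** The i-th face multiplies the entries x_(i-1) and x_i of x_0, ..., x_k.
    With i = 0 every n falls in the last case, so the first entry is dropped;
    with i = k + 1 every n < k falls in the first one, so the last entry is
    dropped. *)
Definition face_coord (i : nat) (x : nat -> G) (n : nat) : G :=
  if (n.+1 < i)%N then x n
  else if n.+1 == i then fmul (x n) (x n.+1) else x n.+1.

Lemma qnorm_face_coord k i (x : fibpow G k.+1) n :
  qnorm (face_coord i (gnth x) n) = qnorm x.
Proof.
by rewrite /face_coord; do 2?case: ifP; rewrite ?qnorm_fmul qnorm_gnth.
Qed.

Definition face k (i : nat) (x : fibpow G k.+1) : fibpow G k :=
  mk_fibpow (fun j : 'I_k => qnorm_face_coord i x j).

Lemma gnth_face k i (x : fibpow G k.+1) n : (n < k)%N ->
  gnth (face i x) n = face_coord i (gnth x) n.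
Proof. by move=> nk; rewrite -[n]/(val (Ordinal nk)) gnth_ord. Qed.

Lemma face0 k (x : fibpow G k.+1) : face 0 x = drop_first x.
Proof.
apply: fibpow_eq => // n nk; rewrite gnth_face// /face_coord /=.
rewrite -[n]/(val (Ordinal nk)) gnth_ord.
by rewrite -[(val _).+1]/(val (lift ord0 (Ordinal nk))) gnth_ord.
Qed.

Lemma face_last k (x : fibpow G k.+1) : face k.+1 x = drop_last x.
Proof.
apply: fibpow_eq => // n nk; rewrite gnth_face// /face_coord ltnS nk.
rewrite -[n]/(val (Ordinal nk)) [RHS]gnth_ord.
by rewrite -[val _]/(val (widen_ord (leqnSn k) (Ordinal nk))) gnth_ord.
Qed.

Lemma face_contract k (i : 'I_k) (x : fibpow G k.+1) :
  face i.+1 x = contract i x.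
Proof.
apply: fibpow_eq => // n nk; rewrite gnth_face// /face_coord ltnS eqSS.
rewrite -[n]/(val (Ordinal nk)) [RHS]gnth_ord; set j := Ordinal nk.
rewrite -[(val j).+1]/(val (lift ord0 j)) gnth_ord.
rewrite -[in gnth x (val j)](_ : val (widen_ord (leqnSn k) j) = val j)// gnth_ord.
rewrite [RHS]/gcoord /= /contract_coord.
case: ifP => // _; rewrite -val_eqE /=; case: eqP => // ji.
have -> : j = i by exact: val_inj.
exact: fmulE.
Qed.

(** The two sides have visibly the same entries, except the entry of index
    i - 1 when i = j > 0: it is a product of three consecutive entries of x,
    bracketed in the two possible ways. *)
Lemma faceC k i j (x : fibpow G k.+2) : (j <= i)%N ->
  face j (face i.+1 x) = face i (face j x).
Proof.
move=> ji; apply: fibpow_eq => // n nk; rewrite !gnth_face// /face_coord.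
have nk1 : (n < k.+1)%N := leqW nk.
rewrite !gnth_face// /face_coord.
have A : fmul (gnth x n) (fmul (gnth x n.+1) (gnth x n.+2)) =
   fmul (fmul (gnth x n) (gnth x n.+1)) (gnth x n.+2).
  by rewrite fmulA// !qnorm_gnth.
by repeat case: ifP => ?; rewrite ?A//; lia.
Qed.

(** Letting the unit act on the terms with i > 0 gives all the terms of the
    differential the same form. *)
Definition twist k (i : nat) (x : fibpow G k) : hat_pi0 G :=
  if i == 0 then eta (gnth x 0) else 1%g.

(** The only case with nontrivial content is i = j = 0, where it says that
    eta (g_1 g_2) = eta g_1 eta g_2. *)
Lemma twistC k i j (x : fibpow G k.+2) : (j <= i)%N ->
  (twist i.+1 x * twist j (face i.+1 x) =
   twist j x * twist i (face j x))%g.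
Proof.
rewrite /twist mul1g; case: j => [_|j]; last by case: i => // i _; rewrite mul1g.
rewrite !gnth_face// /face_coord /=; case: i => [|i] /=; last by rewrite mulg1.
by rewrite eta_fmul// !qnorm_gnth.
Qed.

Lemma dvalueE k M (a : cochain k M) (x : fibpow G k.+1) :
  dvalue a x =
  \sum_(i < k.+2) gact (twist i x) (value a (face i x)) *~ (-1) ^+ i.
Proof.
rewrite big_ord_recl big_ord_recr /= addrA /dvalue face0 face_last.
rewrite /twist /= gact1 -[0%N]/(val (ord0 : 'I_k.+1)) gnth_ord.
congr (_ + _ + _); apply: eq_bigr => i _.
by rewrite gact1 /bump add1n face_contract.
Qed.

Lemma gact_sum M (g : hat_pi0 G) n (F : 'I_n -> M) :
  gact g (\sum_(i < n) F i *~ (-1) ^+ i) =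
  \sum_(i < n) gact g (F i) *~ (-1) ^+ i.
Proof.
have g0 : gact g (0 : M) = 0 by rewrite -{1}(subrr 0) gactB subrr.
rewrite (big_morph _ (@gactD _ M g) g0); apply: eq_bigr => i _.
rewrite -signr_odd; case: (odd i); rewrite ?expr1 ?expr0 ?mulr1z//.
by rewrite !mulrN1z -[- F i]add0r gactB g0 add0r.
Qed.

Lemma cdiffK k M (a : cochain k M) : cdiff (cdiff a) = 0.
Proof.
apply: value_inj => x; rewrite value_cdiff dvalueE value0.
under eq_bigr do rewrite value_cdiff dvalueE gact_sum.
pose T i j : M := gact (twist i x)
  (gact (twist j (face i x)) (value a (face j (face i x)))).
apply: (@alternating_sum_eq0 _ _ T) => i j /andP[ji _].
by rewrite /T -!gactM twistC// faceC.
Qed.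

End Faces.

(** * Short exact sequences of cochain groups *)

Section ExactSequence.
Variables (R : realType) (Q : topologicalType) (G : qgroup R Q).
Implicit Types (M N : gmodule (hat_pi0 G)) (S : ses (hat_pi0 G)).

Lemma value_map k M N (f : ghom M N) (a : cochain k M) x :
  value (cochain_map f a) x = f (value a x).
Proof. by []. Qed.

(** Compose c with a set-theoretic section s of f: the map s o c is constant
    wherever c is.  Asking only that f hit the values of c serves both the
    surjectivity of the projection and exactness in the middle. *)
Lemma cochain_map_lift k M N (f : ghom M N) (c : cochain k N) :
  (forall x, exists m, f m = value c x) -> exists a, cochain_map f a = c.
Proof.
move=> fc; pose s n := xget 0 [set m | f m = n].
have sc x : nbhs x [set y | s (value c y) = s (value c x)].
  by apply: filterS (value_locally_constant c x) => y /= ->.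
exists (mk_cochain sc); apply: value_inj => x; rewrite value_map.
exact: (@xgetPex M 0 [set m | f m = value c x] (fc x)).
Qed.

Lemma proj_cochain_surj k S (c : cochain k (ses_quo S)) :
  exists a, cochain_map (ses_proj S) a = c.
Proof. by apply: cochain_map_lift => x; exact: ses_projP. Qed.

Lemma inj_cochain_inj k S : injective (@cochain_map _ _ G _ _ (ses_inj S) k).
Proof.
move=> a b ab; apply: value_inj => x; apply: (@ses_injP _ S).
by rewrite -!value_map ab.
Qed.

Lemma cochain_exact k S (a : cochain k (ses_mid S)) :
  cochain_map (ses_proj S) a = 0 <-> exists c, cochain_map (ses_inj S) c = a.
Proof.
split=> [pa|[c <-]].
  apply: cochain_map_lift => x; apply/ses_exact.
  by rewrite -value_map pa value0.
apply: value_inj => x; rewrite !value_map value0.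
by apply/ses_exact; exists (value c x).
Qed.

Lemma cocycle_eq0 k M (z : cocycle k M) : cdiff z = 0.
Proof. exact/eqP/(cocycleP z). Qed.

Lemma mk_cocycle k M (a : cochain k M) :
  cdiff a = 0 -> exists z : cocycle k M, z = a :> cochain k M.
Proof.
by move=> /eqP da; exists (Cocycle (da : a \in @cocycle_pred _ _ G k M)).
Qed.

Lemma cclass_eq0 k M (z : cocycle k M) : cclass z = 0 <-> is_coboundary z.
Proof.
rewrite -(raddf0 (@cclass _ _ G k M)) /cclass.
split=> [/eqP|bz]; last apply/eqP.
  by rewrite -Quotient.idealrBE subr0 => /asboolP.
by rewrite -Quotient.idealrBE subr0; exact/asboolP.
Qed.

(** This lets every argument below treat degree 0 and positive degrees alike: a
    cochain lifting a coboundary can be corrected by a coboundary into one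
    that comes from the submodule. *)
Lemma coboundary_lift k S (z : cocycle k (ses_quo S)) : is_coboundary z ->
  exists2 v : cocycle k (ses_mid S),
    is_coboundary v & cochain_map (ses_proj S) v = z.
Proof.
case: k z => [|k] z /= => [->|[w dw]]; first by exists 0; rewrite // raddf0.
have [u pu] := proj_cochain_surj w; have [v vE] := mk_cocycle (cdiffK u).
by exists v; [exists u | rewrite vE -cdiff_cochain_map pu].
Qed.

Lemma coboundary_cocycle k M (z : cocycle k.+1 M) (a : cochain k M) :
  cdiff a = z -> cclass z = 0.
Proof. by move=> az; apply/cclass_eq0; exists a. Qed.

(** * The connecting morphism *)

(** The data of the snake construction: a lifts z, and b is what the coboundary
    of a comes from. *)
Definition snake k S (a : cochain k (ses_mid S)) (z : cocycle k (ses_quo S))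
    (b : cocycle k.+1 (ses_sub S)) : Prop :=
  cochain_map (ses_proj S) a = z /\ cdiff a = cochain_map (ses_inj S) b.

Lemma snake_exists k S (z : cocycle k (ses_quo S)) :
  exists a b, snake a z b.
Proof.
have [a az] := proj_cochain_surj z.
have [|c ca] := (cochain_exact (cdiff a)).1.
  by rewrite -cdiff_cochain_map az cocycle_eq0.
have [|b bc] := mk_cocycle (a := c).
  by apply: inj_cochain_inj; rewrite -cdiff_cochain_map ca cdiffK raddf0.
by exists a, b; split; rewrite ?bc.
Qed.

Lemma snakeB k S (a a' : cochain k (ses_mid S)) z z' b b' :
  snake a z b -> snake a' z' b' -> snake (a - a') (z - z') (b - b').
Proof.
by move=> [az ab] [az' ab']; split; rewrite !raddfB /= ?az ?az' ?ab ?ab'.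
Qed.

(** As z is a coboundary, it lifts to a coboundary v of the middle module; then
    a - v comes from a cochain c of the submodule, and c bounds b since v is a
    cocycle. *)
Lemma snake_eq0 k S (a : cochain k (ses_mid S)) z b :
  snake a z b -> cclass z = 0 -> cclass b = 0.
Proof.
move=> [az ab] /cclass_eq0/coboundary_lift[v _ vz].
have [|c ca] := (cochain_exact (a - cocycle_val v)).1.
  by rewrite raddfB /= az vz subrr.
apply: (@coboundary_cocycle _ _ _ c); apply: inj_cochain_inj.
by rewrite -cdiff_cochain_map ca raddfB /= cocycle_eq0 subr0.
Qed.

(** Snake data form a group, so independence of all choices reduces to
    snake_eq0. *)
Lemma snake_uniq k S (a a' : cochain k (ses_mid S)) z z' b b' :
  snake a z b -> snake a' z' b' -> cclass z = cclass z' -> cclass b = cclass b'.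
Proof.
move=> s s' zz'; apply/eqP; rewrite -subr_eq0 -raddfB; apply/eqP.
by apply: (snake_eq0 (snakeB s s')); rewrite raddfB /= zz' subrr.
Qed.

Lemma connecting_value_exists k S (h : cohomology k (ses_quo S)) :
  { h' : cohomology k.+1 (ses_sub S) | exists a z b,
    [/\ snake a z b, cclass z = h & cclass b = h'] }.
Proof.
apply: cid; have [z <-] := cclass_surj h; have [a [b s]] := snake_exists z.
by exists (cclass b), a, z, b.
Qed.

Definition connecting k S (h : cohomology k (ses_quo S)) :
  cohomology k.+1 (ses_sub S) := projT1 (connecting_value_exists h).

Lemma connectingE k S (a : cochain k (ses_mid S)) z b :
  snake a z b -> connecting (cclass z) = cclass b.
Proof.
rewrite /connecting => s.
case: connecting_value_exists => h /= [a' [z' [b' [s' zz' bh]]]].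
by rewrite -bh; exact: snake_uniq s' s zz'.
Qed.

Lemma connecting_is_zmod_morphism k S : zmod_morphism (@connecting k S).
Proof.
move=> h h'; have [z <-] := cclass_surj h; have [z' <-] := cclass_surj h'.
have [a [b s]] := snake_exists z; have [a' [b' s']] := snake_exists z'.
rewrite -raddfB (connectingE (snakeB s s')).
by rewrite (connectingE s) (connectingE s') raddfB.
Qed.
HB.instance Definition _ k S := GRing.isZmodMorphism.Build
  (cohomology k (ses_quo S)) (cohomology k.+1 (ses_sub S))
  (@connecting k S) (@connecting_is_zmod_morphism k S).

Definition connecting_morphism k S :
  {additive cohomology k (ses_quo S) -> cohomology k.+1 (ses_sub S)} :=
  @connecting k S.

Lemma connecting_is_connecting : is_connecting connecting_morphism.
Proof. by move=> k S a z b az ab; exact: (@connectingE _ _ a). Qed.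

(** * The long exact sequence *)

Lemma cohomology_map_eq k M N (f : ghom M N) (z : cocycle k M)
    (w : cocycle k N) : cochain_map f z = w ->
  cohomology_map f (cclass z) = cclass w.
Proof. by move=> zw; rewrite cohomology_mapE; congr cclass; exact: val_inj. Qed.

Lemma snake_natural k S S' (s : ses_hom S S') (a : cochain k (ses_mid S)) z b :
  snake a z b -> snake (cochain_map (sh_mid s) a)
    (cocycle_map (sh_quo s) z) (cocycle_map (sh_sub s) b).
Proof.
move=> [az ab]; split.
  by rewrite /= -az; apply: value_inj => x; rewrite !value_map sh_proj.
by rewrite cdiff_cochain_map ab; apply: value_inj => x; rewrite !value_map sh_inj.
Qed.

(** If u becomes a coboundary in the quotient, subtracting a coboundary v with
    the same image moves u into the image of the submodule, where it is still
    a cocycle by injectivity on cochains. *)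
Lemma cohomology_exact_mid k S (y : cohomology k (ses_mid S)) :
  cohomology_map (ses_proj S) y = 0 <->
  exists x, cohomology_map (ses_inj S) x = y.
Proof.
split=> [|[x <-]]; last first.
  have [c <-] := cclass_surj x; rewrite !cohomology_mapE.
  suff -> : cocycle_map (ses_proj S) (cocycle_map (ses_inj S) c) = 0.
    exact: raddf0.
  by apply: val_inj; apply/cochain_exact; exists c.
have [u <-] := cclass_surj y; rewrite cohomology_mapE => /cclass_eq0.
move=> /coboundary_lift[v bv vu].
have [|c cuv] := (cochain_exact (cocycle_val u - cocycle_val v)).1.
  by rewrite raddfB /= vu subrr.
have [|w wc] := mk_cocycle (a := c).
  apply: inj_cochain_inj; rewrite -cdiff_cochain_map cuv raddfB /=.
  by rewrite !cocycle_eq0 subrr raddf0.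
exists (cclass w); rewrite (@cohomology_map_eq _ _ _ _ _ (u - v)) ?wc//.
by rewrite raddfB /= (cclass_eq0 v).2// subr0.
Qed.

(** If b = dc, correcting the lift a by c turns it into a cocycle over z;
    conversely a cocycle of the middle module is a lift with b = 0. *)
Lemma cohomology_exact_quo k S (h : cohomology k (ses_quo S)) :
  connecting h = 0 <-> exists y, cohomology_map (ses_proj S) y = h.
Proof.
split=> [|[y <-]].
  have [z <-] := cclass_surj h; have [a [b s]] := snake_exists z.
  rewrite (connectingE s) => /cclass_eq0[c dc]; case: s => az ab.
  have [|y yE] := mk_cocycle (a := a - cochain_map (ses_inj S) c).
    by rewrite raddfB /= cdiff_cochain_map dc ab subrr.
  exists (cclass y); apply: cohomology_map_eq.
  by rewrite yE raddfB /= az (cochain_exact _).2 ?subr0//; exists c.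
have [u <-] := cclass_surj y; rewrite cohomology_mapE.
rewrite (@connectingE _ _ u _ 0) ?raddf0//; split => //.
by rewrite cocycle_eq0 raddf0.
Qed.

(** A cochain a of the middle module that bounds the image of b is itself a
    piece of snake data: its projection is a cocycle with connecting image b. *)
Lemma cohomology_exact_sub k S (h : cohomology k.+1 (ses_sub S)) :
  cohomology_map (ses_inj S) h = 0 <-> exists z, connecting z = h.
Proof.
split=> [|[z <-]].
  have [b <-] := cclass_surj h; rewrite cohomology_mapE => /cclass_eq0[a da].
  have [|z zE] := mk_cocycle (a := cochain_map (ses_proj S) a).
    by rewrite cdiff_cochain_map da; apply/cochain_exact; exists b.
  by exists (cclass z); apply: (@connectingE _ _ a); split.
have [w <-] := cclass_surj z; have [a [b s]] := snake_exists w.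
rewrite (connectingE s) cohomology_mapE; case: s => _ ab.
exact: (@coboundary_cocycle _ _ _ a).
Qed.

Lemma cohomology0_inj S : injective (@cohomology_map _ _ G _ _ (ses_inj S) 0).
Proof.
apply: raddf_inj => h; have [z <-] := cclass_surj h.
rewrite /= cohomology_mapE => /cclass_eq0/(congr1 val) /= iz0.
suff -> : z = 0 by exact: raddf0.
by apply: val_inj; apply: inj_cochain_inj; rewrite iz0 raddf0.
Qed.

Lemma connecting_delta_functor :
  delta_functor (@cohomology_functor R Q G) connecting_morphism.
Proof.
split.
- move=> k M x; have [z <-] := cclass_surj x; apply: cohomology_map_eq.
  exact: value_inj.
- move=> k M N P g f x; have [z <-] := cclass_surj x.
  rewrite /= !cohomology_mapE; congr cclass.
  by apply: val_inj; exact: value_inj.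
- move=> k M N f g x; have [z <-] := cclass_surj x.
  rewrite /= !cohomology_mapE -raddfD; congr cclass.
  by apply: val_inj; exact: value_inj.
- move=> k S S' s h; have [z <-] := cclass_surj h.
  have [a [b sn]] := snake_exists z.
  rewrite /= (connectingE sn) !cohomology_mapE.
  by rewrite (connectingE (snake_natural s sn)).
- exact: cohomology0_inj.
- exact: cohomology_exact_mid.
- exact: cohomology_exact_quo.
- exact: cohomology_exact_sub.
Qed.

End ExactSequence.

(** * Uniqueness of the connecting morphisms *)

(** Additivity is a proposition, so two additive maps differ at most in their
    underlying functions. *)
Lemma additive_eq (U V : zmodType) (f g : {additive U -> V}) : f =1 g -> f = g.
Proof.
case: f g => f [[f0]] [g [[g0]]] /= /funext fg.
case: _ / fg in g0 *; congr (GRing.Additive.Pack (GRing.Additive.Class _)).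
congr (GRing.isNmodMorphism.Axioms_ _).
exact: Prop_irrelevance.
Qed.

Theorem proposition1p25 (R : realType) (Q : topologicalType)
    (Q_hausdorff : hausdorff_space Q)
    (Q_connected : connected [set: Q])
    (Q_lpc : locally_path_connected R Q)
    (G : qgroup R Q)
    (G_slpc : simultaneously_lpc G) :
  exists! delta : (forall k (S : ses (hat_pi0 G)),
      {additive cohomology k (ses_quo S) -> cohomology k.+1 (ses_sub S)}),
    is_connecting delta /\ delta_functor (@cohomology_functor R Q G) delta.
Proof.
exists (@connecting_morphism R Q G); split.
  by split; [exact: connecting_is_connecting | exact: connecting_delta_functor].
move=> delta [dc _]; apply: functional_extensionality_dep => k.
apply: functional_extensionality_dep => S; apply: additive_eq => h.
have [z <-] := cclass_surj h; have [a [b s]] := snake_exists z.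
by case: (s) => az ab; rewrite (dc _ _ _ _ _ az ab) /= (connectingE s).
Qed.
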